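(* Let $K$ be an arbitrary field of characteristic $0$ such that the equation $\lambda^2+\lambda+1=0$ has no solution in $K$, and let $\alpha\in K$. If $\alpha^3\neq1$ (i.e. $\alpha\neq1$), then $$\mathrm{Aut}\,E_\alpha\cong K^*\times Z_3 .$$
   Context: For $\alpha\in K$ put $C=\frac13(x^3+y^3+z^3)-\alpha xyz\in K[x,y,z]$. The elliptic Poisson algebra $E_\alpha$ is the polynomial algebra $K[x,y,z]$ endowed with the Poisson bracket determined by $\{x,y\}=-\alpha xy+z^2$, $\{y,z\}=-\alpha yz+x^2$, $\{z,x\}=-\alpha zx+y^2$; equivalently $\{u,v\}=J(u,v,C)$ for all $u,v\in K[x,y,z]$, where $J(f_1,f_2,f_3)$ is the determinant of the Jacobian matrix of $(f_1,f_2,f_3)$ with respect to $(x,y,z)$. An automorphism of a Poisson algebra $P$ over $K$ is a bijective $K$-linear map $\phi:P\to P$ with $\phi(ab)=\phi(a)\phi(b)$ and $\phi(\{a,b\})=\{\phi(a),\phi(b)\}$ for all $a,b\in P$. $\mathrm{Aut}\,E_\alpha$ is the group of automorphisms of $E_\alpha$ as a Poisson algebra. $K^*$ is the multiplicative group of $K$ and $Z_3$ is the cyclic group of order $3$. *)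

(* Defs.v *)
From HB Require Import structures.
From mathcomp Require Import all_boot all_order all_algebra all_fingroup.
From mathcomp Require Import ring.
From mathcomp Require Import boolp.
From mathcomp Require Import mpoly.

Set Implicit Arguments.
Unset Strict Implicit.
Unset Printing Implicit Defensive.

Import GRing.Theory.
Local Open Scope ring_scope.

(* The group K^* of units; [{unit R}] in finalg is restricted to finite R. *)
Record units (R : comUnitRingType) := Units {
  units_val :> R;
  _ : units_val \is a GRing.unit }.

HB.instance Definition _ (R : comUnitRingType) := [isSub for @units_val R].
HB.instance Definition _ (R : comUnitRingType) := [Choice of units R by <:].

Section UnitsGroup.
Variable R : comUnitRingType.
Implicit Types a b c : units R.

Let units1 : units R := Units (@unitr1 R).
Let units_mul_subproof a b : (a : R) * (b : R) \is a GRing.unit.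
Proof. by rewrite unitrM (valP a) (valP b). Qed.
Let units_mul a b := Units (units_mul_subproof a b).
Let units_inv_subproof a : (a : R)^-1 \is a GRing.unit.
Proof. by rewrite unitrV (valP a). Qed.
Let units_inv a := Units (units_inv_subproof a).

Let units_mulA : associative units_mul.
Proof. by move=> a b c; apply: val_inj; apply: mulrA. Qed.
Let units_mul1 : left_id units1 units_mul.
Proof. by move=> a; apply: val_inj; apply: mul1r. Qed.
Let units_1mul : right_id units1 units_mul.
Proof. by move=> a; apply: val_inj; apply: mulr1. Qed.
Let units_mulV : left_inverse units1 units_inv units_mul.
Proof. by move=> a; apply: val_inj; apply: mulVr; apply: (valP a). Qed.
Let units_Vmul : right_inverse units1 units_inv units_mul.
Proof. by move=> a; apply: val_inj; apply: mulrV; apply: (valP a). Qed.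

HB.instance Definition _ :=
  isGroup.Build (units R) units_mulA units_mul1 units_1mul units_mulV units_Vmul.

Lemma units_valM a b : ((a * b)%g : R) = (a : R) * (b : R). Proof. by []. Qed.
End UnitsGroup.

Record poissonBracket (K : fieldType) (P : comAlgType K) := PoissonBracket {
  pbracket :> P -> P -> P;
  pbracket_linearl : forall w, linear (pbracket^~ w);
  pbracket_linearr : forall u, linear (pbracket u);
  pbracketxx : forall u, pbracket u u = 0;
  pbracket_jacobi : forall u v w, pbracket u (pbracket v w)
    + pbracket v (pbracket w u) + pbracket w (pbracket u v) = 0;
  pbracket_leibniz : forall u v w,
    pbracket (u * v) w = u * pbracket v w + pbracket u w * v }.

Section PoissonAut.
Variables (K : fieldType) (P : comAlgType K) (br : poissonBracket P).

(* Preservation of 1 follows from bijectivity and multiplicativity. *)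
Definition is_poisson_aut (phi : P -> P) : Prop :=
  [/\ bijective phi, linear phi,
      {morph phi : a b / a * b} & {morph phi : a b / br a b}].

Record poissonAut := PoissonAut {
  poisson_aut_fun :> P -> P;
  _ : `[< is_poisson_aut poisson_aut_fun >] }.

HB.instance Definition _ := [isSub for poisson_aut_fun].
HB.instance Definition _ := [Choice of poissonAut by <:].

Implicit Types f g h : poissonAut.

Lemma poissonAutP f : is_poisson_aut f.
Proof. by apply/asboolP; case: f. Qed.

Let paut1_subproof : `[< is_poisson_aut id >].
Proof. by apply/asboolP; split=> //; exists id. Qed.
Let paut1 := PoissonAut paut1_subproof.

Let paut_mul_subproof f g : `[< is_poisson_aut (f \o g) >].
Proof.
apply/asboolP; have [bf lf mf pf] := poissonAutP f.
have [bg lg mg pg] := poissonAutP g; split; first exact: bij_comp.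
- by move=> k a b /=; rewrite lg lf.
- by move=> a b /=; rewrite mg mf.
- by move=> a b /=; rewrite pg pf.
Qed.
Let paut_mul f g := PoissonAut (paut_mul_subproof f g).

Let paut_inv_ex f : exists k : P -> P, cancel f k /\ cancel k f.
Proof. by have [[k fK kK] _ _ _] := poissonAutP f; exists k. Qed.
Let paut_inv_fun f : P -> P := projT1 (cid (paut_inv_ex f)).
Let paut_invK f : cancel f (paut_inv_fun f).
Proof. by have [] := projT2 (cid (paut_inv_ex f)). Qed.
Let paut_Kinv f : cancel (paut_inv_fun f) f.
Proof. by have [] := projT2 (cid (paut_inv_ex f)). Qed.

Let paut_inv_subproof f : `[< is_poisson_aut (paut_inv_fun f) >].
Proof.
have [bf lf mf pf] := poissonAutP f; have injf := bij_inj bf.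
apply/asboolP; split; first by exists f; [exact: paut_Kinv | exact: paut_invK].
- by move=> k a b; apply: injf; rewrite lf !paut_Kinv.
- by move=> a b; apply: injf; rewrite mf !paut_Kinv.
- by move=> a b; apply: injf; rewrite pf !paut_Kinv.
Qed.
Let paut_inv f := PoissonAut (paut_inv_subproof f).

Let paut_mulA : associative paut_mul.
Proof. by move=> f g h; apply: val_inj. Qed.
Let paut_mul1 : left_id paut1 paut_mul.
Proof. by move=> f; apply: val_inj. Qed.
Let paut_1mul : right_id paut1 paut_mul.
Proof. by move=> f; apply: val_inj. Qed.
Let paut_mulV : left_inverse paut1 paut_inv paut_mul.
Proof. by move=> f; apply: val_inj; apply/funext=> a; apply: paut_invK. Qed.
Let paut_Vmul : right_inverse paut1 paut_inv paut_mul.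
Proof. by move=> f; apply: val_inj; apply/funext=> a; apply: paut_Kinv. Qed.

HB.instance Definition _ :=
  isGroup.Build poissonAut paut_mulA paut_mul1 paut_1mul paut_mulV paut_Vmul.

Lemma poisson_autM f g : ((f * g)%g : P -> P) = f \o g. Proof. by []. Qed.
End PoissonAut.

Lemma det_mx22 (R : comNzRingType) (A : 'M[R]_2) :
  \det A = A 0 0 * A 1 1 - A 0 1 * A 1 0.
Proof.
rewrite (expand_det_row _ 0) !big_ord_recl big_ord0 /cofactor !det_mx11 !mxE.
have ->: lift 0 0 = 1 :> 'I_2 by apply: val_inj.
have ->: lift 1 0 = 0 :> 'I_2 by apply: val_inj.
rewrite /= !addn0 !add0n expr0 expr1; ring.
Qed.
Lemma det_mx33 (R : comNzRingType) (A : 'M[R]_3) :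
  \det A = A 0 0 * (A 1 1 * A 2 2 - A 1 2 * A 2 1)
         - A 0 1 * (A 1 0 * A 2 2 - A 1 2 * A 2 0)
         + A 0 2 * (A 1 0 * A 2 1 - A 1 1 * A 2 0).
Proof.
rewrite (expand_det_row _ 0) !big_ord_recl big_ord0 /cofactor !det_mx22 !mxE.
have ->: lift 0 (lift 0 0) = 2 :> 'I_3 by apply: val_inj.
have ->: lift 0 0 = 1 :> 'I_3 by apply: val_inj.
have ->: lift 0 1 = 2 :> 'I_3 by apply: val_inj.
have ->: lift 1 0 = 0 :> 'I_3 by apply: val_inj.
have ->: lift 2 0 = 0 :> 'I_3 by apply: val_inj.
have ->: lift 1 1 = 2 :> 'I_3 by apply: val_inj.
have ->: lift 2 1 = 1 :> 'I_3 by apply: val_inj.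
rewrite /= !addn0 !add0n expr0 expr1 /bump /=; ring.
Qed.

Definition isomorphic_groups (G H : groupType) : Prop :=
  exists2 f : G -> H, bijective f & {morph f : a b / (a * b)%g}.

Lemma expr3_neq1 (K : fieldType)
    (no_root : forall lambda : K, lambda ^+ 2 + lambda + 1 <> 0) (alpha : K) :
  alpha ^+ 3 <> 1 <-> alpha <> 1.
Proof.
split=> neq1 eq1; apply: neq1; first by rewrite eq1 expr1n.
have : (alpha - 1) * (alpha ^+ 2 + alpha + 1) = 0 by ring: eq1.
by move/eqP; rewrite mulf_eq0 subr_eq0 => /orP[/eqP //|/eqP/no_root].
Qed.

Section Elliptic.
Variable K : fieldType.
Local Notation P := {mpoly K[3]}.
Implicit Types (alpha : K) (u v w f g h : P).

Definition vx : P := 'X_(0 : 'I_3).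
Definition vy : P := 'X_(1 : 'I_3).
Definition vz : P := 'X_(2 : 'I_3).

Definition jacobian f g h : P :=
  \det (\matrix_(i < 3, j < 3) (tnth [tuple f; g; h] i)^`M(j)).

Definition elliptic_potential alpha : P :=
  3^-1 *: (vx ^+ 3 + vy ^+ 3 + vz ^+ 3) - alpha *: (vx * vy * vz).

Local Notation dx := (mderiv (0 : 'I_3)).
Local Notation dy := (mderiv (1 : 'I_3)).
Local Notation dz := (mderiv (2 : 'I_3)).

Lemma jacobianE f g h : jacobian f g h =
    dx f * (dy g * dz h - dz g * dy h) - dy f * (dx g * dz h - dz g * dx h)
  + dz f * (dx g * dy h - dy g * dx h).
Proof. by rewrite /jacobian det_mx33 !mxE. Qed.

Section JacobianBracket.
Variable h : P.

Let jac u v := jacobian u v h.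

Lemma jacobian_linearl w : linear (jac^~ w).
Proof.
move=> k u v; rewrite /jac !jacobianE !mderivD !mderivZ -!mul_mpolyC; ring.
Qed.

Lemma jacobian_linearr u : linear (jac u).
Proof.
move=> k v w; rewrite /jac !jacobianE !mderivD !mderivZ -!mul_mpolyC; ring.
Qed.

Lemma jacobianxx u : jac u u = 0.
Proof. rewrite /jac jacobianE; ring. Qed.

Lemma jacobian_leibniz u v w : jac (u * v) w = u * jac v w + jac u w * v.
Proof. rewrite /jac !jacobianE !mderivM; ring. Qed.

Lemma mderiv_jacobian (i : 'I_3) u v : (jac u v)^`M(i) =
  jac u^`M(i) v + jac u v^`M(i) + jacobian u v h^`M(i).
Proof.
rewrite /jac !jacobianE !(mderivD, mderivN, mderivM).
rewrite !(mderiv_comm 0 i) !(mderiv_comm 1 i) !(mderiv_comm 2 i).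
ring.
Qed.

Lemma jacobian_jacobi u v w :
  jac u (jac v w) + jac v (jac w u) + jac w (jac u v) = 0.
Proof.
pose D a b c a' b' c' a2 b2 c2 : P := a * (b' * c2 - c' * b2)
  - b * (a' * c2 - c' * a2) + c * (a' * b2 - b' * a2).
have jacD f g k : jacobian f g k =
    D (dx f) (dy f) (dz f) (dx g) (dy g) (dz g) (dx k) (dy k) (dz k).
  exact: jacobianE.
have jac2 f g k : jac f (jac g k) =
    D (dx f) (dy f) (dz f) (dx (jac g k)) (dy (jac g k)) (dz (jac g k))
      (dx h) (dy h) (dz h).
  exact: jacobianE.
rewrite !jac2 !mderiv_jacobian /jac !jacD.
rewrite !(mderiv_comm 1 0) !(mderiv_comm 2 0) !(mderiv_comm 2 1).
repeat match goal with
  |- context [mderiv ?i (mderiv ?j ?p)] => move: (mderiv i (mderiv j p)) => ?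
end.
repeat match goal with |- context [mderiv ?i ?p] => move: (mderiv i p) => ? end.
rewrite /D; ring.
Qed.

Definition jacobian_bracket : poissonBracket P := PoissonBracket
  jacobian_linearl jacobian_linearr jacobianxx jacobian_jacobi jacobian_leibniz.
End JacobianBracket.

Definition elliptic_bracket alpha : poissonBracket P :=
  jacobian_bracket (elliptic_potential alpha).

Lemma mderiv_var (i j : 'I_3) : ('X_i : P)^`M(j) = (i == j)%:R.
Proof.
rewrite mderivX mnm1E; case: eqP => [->|_]; last by rewrite scale0r.
by rewrite -{1}[U_(j)%MM]add0m addmK mpolyX0 scale1r.
Qed.

Section Generators.
Hypothesis charK : [pchar K] =i pred0.
Variable alpha : K.

Let potentialE : elliptic_potential alpha =
  (3^-1)%:MP * (vx ^+ 3 + vy ^+ 3 + vz ^+ 3) - alpha%:MP * (vx * vy * vz).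
Proof. by rewrite /elliptic_potential -!mul_mpolyC. Qed.

Let third3 : (3^-1 : K)%:MP * 3 = 1 :> P.
Proof.
rewrite -[3 in X in _ * X]mpolyC_nat -mpolyCM mulVf ?mpolyC1 //.
by have /pcharf0P -> := charK.
Qed.

Let var_bracketE := (potentialE, jacobianE, exprS, expr0, mderivN, mderivD,
  mderivM, mderivC, mderiv_var).

Lemma elliptic_bracket_xy :
  elliptic_bracket alpha vx vy = - (alpha *: (vx * vy)) + vz ^+ 2.
Proof.
rewrite /= !var_bracketE /= -mul_mpolyC; ring: third3.
Qed.

Lemma elliptic_bracket_yz :
  elliptic_bracket alpha vy vz = - (alpha *: (vy * vz)) + vx ^+ 2.
Proof.
rewrite /= !var_bracketE /= -mul_mpolyC; ring: third3.
Qed.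

Lemma elliptic_bracket_zx :
  elliptic_bracket alpha vz vx = - (alpha *: (vz * vx)) + vy ^+ 2.
Proof.
rewrite /= !var_bracketE /= -mul_mpolyC; ring: third3.
Qed.
End Generators.
End Elliptic.

(* Main.v *)
From HB Require Import structures.
Require Import Defs.
From mathcomp Require Import all_boot all_order all_algebra all_fingroup.
From mathcomp Require Import boolp mpoly ring.

Set Implicit Arguments.
Unset Strict Implicit.
Unset Printing Implicit Defensive.

Import GRing.Theory.
(** Write C for the potential, C_0, C_1, C_2 for its partial derivatives and
X_0, X_1, X_2 for the variables, with indices mod 3. The bracket relations are
{X_(i+1), X_(i+2)} = C_i. Let phi be a Poisson automorphism and F_i = phi(X_i),
so that {F_(i+1), F_(i+2)} = C_i(F). The whole proof is a study of such triples.

- By the chain rule grad (C o F) = J grad C, where J is the Jacobian determinant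
  of F ([deriv_cubic_relations]). As phi is invertible, J is a unit of the
  polynomial ring, hence a nonzero constant ([poisson_aut_jacobian]), and
  C o F = J C + constant.

- F has degree at most 1 ([relations_affine]). Let G be the part of F of
  degree d, where d >= 2 bounds the degrees of the F_i. Taking leading parts, G
  satisfies the same relations, and C(G) = 0 because 3d > 3. So G would be a
  polynomial parametrization of the cubic curve C = 0, which is smooth as
  alpha^3 is not 1, hence of genus 1: G must be constant up to a common factor
  ([hesse_parametrization_constant]). But then all brackets of the G_i vanish,
  that is grad C (G) = 0, and smoothness gives G = 0 ([isotropic_relations]).

- F has no constant term, since at the origin the relations say that grad C
  vanishes at F(0) ([relations_const0]). So F is given by an invertible matrix,
  and comparing coefficients in the relations gives quadratic equations in its
  entries. Since K has no primitive cube root of 1, their only solutions are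
  F_i = c X_(i+s) ([hesse_matrix_cyclic], [relations_cyclic]).

- Conversely X_i |-> c X_(i+s) is a Poisson automorphism, and these compose as
  the pairs (c, s) multiply ([rotation_bracket], [rotation_aut_morph]). *)

Local Open Scope ring_scope.

(** * Indices modulo three *)

Lemma ord3_ind (P : 'I_3 -> Prop) : P 0 -> P 1 -> P 2 -> forall i, P i.
Proof.
move=> P0 P1 P2 [[|[|[|//]]] lti].
- by rewrite (_ : Ordinal lti = 0) //; apply: val_inj.
- by rewrite (_ : Ordinal lti = 1) //; apply: val_inj.
- by rewrite (_ : Ordinal lti = 2) //; apply: val_inj.
Qed.

Lemma ord3D (i : 'I_3) :
  (i + 1 + 1 = i + 2) * (i + 1 + 2 = i) * (i + 2 + 1 = i) * (i + 2 + 2 = i + 1).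
Proof. by split; [split; [split|]|]; apply: val_inj; elim/ord3_ind: i. Qed.

Lemma ord3E : (0 + 1 = 1 :> 'I_3) * (0 + 2 = 2 :> 'I_3) * (1 + 1 = 2 :> 'I_3) *
  (1 + 2 = 0 :> 'I_3) * (2 + 1 = 0 :> 'I_3) * (2 + 2 = 1 :> 'I_3).
Proof. by do !split; apply: val_inj. Qed.

Lemma ord3_case (i : 'I_3) (P : 'I_3 -> Prop) :
  P i -> P (i + 1) -> P (i + 2) -> forall j, P j.
Proof.
move=> P0 P1 P2; elim/ord3_ind: i P0 P1 P2; rewrite !ord3E => ? ? ?.
all: by elim/ord3_ind.
Qed.

Lemma ord3_neq (k : 'I_3) : ((k + 1 == k) = false) * ((k + 2 == k) = false).
Proof. by split; elim/ord3_ind: k. Qed.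

Lemma sum3E (R : nmodType) (F : 'I_3 -> R) : \sum_i F i = F 0 + F 1 + F 2.
Proof.
rewrite !big_ord_recl big_ord0 addr0 addrA.
by congr (_ + F _ + F _); apply: val_inj.
Qed.

Lemma sum3E_from (R : nmodType) (F : 'I_3 -> R) k :
  \sum_i F i = F k + F (k + 1) + F (k + 2).
Proof.
rewrite (reindex_inj (addrI k)) sum3E addr0.
by congr (F _ + _ + _).
Qed.

(** Deduces one equation from another by linear combination: the remaining
identity is left to [ring]. *)
Lemma eq_lin (R : zmodType) (x y z t : R) : x = y -> z - t = x - y -> z = t.
Proof. by move=> ->; rewrite subrr => /subr0_eq. Qed.

(** * The Hesse cubic and its gradient *)

Section HesseCubic.
Variables (R : comNzRingType) (a : R).
Implicit Types u v : 'I_3 -> R.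

(** Three times the elliptic potential, which avoids dividing by 3 over a
general ring. *)
Definition hesse_cubic u : R :=
  u 0 ^+ 3 + u 1 ^+ 3 + u 2 ^+ 3 - 3 * a * (u 0 * u 1 * u 2).

(** The gradient of the elliptic potential, a third of that of
[hesse_cubic]. *)
Definition hesse_grad u (i : 'I_3) : R := u i ^+ 2 - a * (u (i + 1) * u (i + 2)).

Lemma hesse_euler u : \sum_i hesse_grad u i * u i = hesse_cubic u.
Proof. by rewrite sum3E /hesse_grad /hesse_cubic !ord3E; ring. Qed.

(** An explicit form of the smoothness of the cubic: when a ^+ 3 is not 1, the
partial derivatives generate an ideal containing a power of each variable. It
serves both for points ([hesse_smooth]) and for divisibility of polynomials
([hesse_grad_dvd_wronskian]). *)
Lemma hesse_grad_irrelevant u i :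
  (1 - a ^+ 3) * u i ^+ 4 =
    ((1 - a ^+ 3) * (u i ^+ 2 + a * (u (i + 1) * u (i + 2)))
       + a ^+ 4 * (u (i + 1) * u (i + 2))) * hesse_grad u i
    + a ^+ 2 * u (i + 2) ^+ 2 * hesse_grad u (i + 1)
    + a ^+ 3 * (u i * u (i + 2)) * hesse_grad u (i + 2).
Proof. by rewrite /hesse_grad !ord3D; ring. Qed.

End HesseCubic.

Lemma hesse_smooth (R : idomainType) (a : R) (u : 'I_3 -> R) :
  a ^+ 3 != 1 -> (forall i, hesse_grad a u i = 0) -> forall i, u i = 0.
Proof.
move=> a3 g0 i; have := hesse_grad_irrelevant a u i.
rewrite !g0 !mulr0 !addr0 => /eqP; rewrite mulf_eq0 subr_eq0 eq_sym (negPf a3).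
by rewrite expf_eq0 => /eqP.
Qed.

(** * The cubic has no rational parametrization *)

Section Univariate.
Variables (L : fieldType) (a : L).
Hypotheses (a3 : a ^+ 3 != 1) (L3 : 3 != 0 :> L).
Implicit Types f : 'I_3 -> {poly L}.
Local Notation grad f := (hesse_grad a%:P f).
Local Notation wronskian f i :=
  (f (i + 1) * (f (i + 2))^`() - f (i + 2) * (f (i + 1))^`()).

Definition coprime3 f := gcdp (gcdp (f 0) (f 1)) (f 2) %= 1.

Lemma coprimep_dvd_exp (p q : {poly L}) n :
  coprimep p q -> p %| q ^+ n -> p %= 1.
Proof.
by move=> /(coprimep_expr n) /coprimepP; apply; exact: dvdpp.
Qed.

(** The gcd of the n-th powers divides each of them, so it is split off from
them one at a time: its gcd with the first entry, then the gcd of that with the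
second and the third, divides all three entries and is 1. Going back, each of
these gcds divides a power of an entry to which it is coprime, so it is 1. *)
Lemma coprime3_exp f n : coprime3 f -> coprime3 (fun i => f i ^+ n).
Proof.
rewrite /coprime3 => cop; set G := gcdp _ _.
have [G0 G1 G2] : [/\ G %| f 0 ^+ n, G %| f 1 ^+ n & G %| f 2 ^+ n].
  split; rewrite ?dvdp_gcdr //; apply: dvdp_trans (dvdp_gcdl _ _) _.
    exact: dvdp_gcdl.
  exact: dvdp_gcdr.
apply: (coprimep_dvd_exp _ G0); rewrite -gcdp_eqp1.
set E := gcdp G _.
have E1 : E %| f 1 ^+ n by apply: dvdp_trans (dvdp_gcdl _ _) G1.
apply: (coprimep_dvd_exp _ E1); rewrite -gcdp_eqp1.
set H := gcdp E _.
have H2 : H %| f 2 ^+ n.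
  by apply: dvdp_trans (dvdp_gcdl _ _) _; apply: dvdp_trans (dvdp_gcdl _ _) G2.
apply: (coprimep_dvd_exp _ H2); rewrite -gcdp_eqp1.
rewrite -size_poly_eq1 -dvdp1 -(eqp_dvdr _ cop) !dvdp_gcd dvdp_gcdr andbT.
have dvdH := dvdp_gcdl H (f 2); apply/andP; split; apply: dvdp_trans dvdH _.
  exact: dvdp_trans (dvdp_gcdl _ _) (dvdp_gcdr _ _).
exact: dvdp_gcdr.
Qed.

Lemma dvdp_coprime3 f (g w : {poly L}) :
  coprime3 f -> (forall j, g %| w * f j) -> g %| w.
Proof.
move=> cop gw; rewrite -(mulr1 w) -(eqp_dvdr _ (eqp_mull w cop)).
rewrite -(eqp_dvdr _ (gcdp_mul2l _ _ _)) dvdp_gcd gw andbT.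
by rewrite -(eqp_dvdr _ (gcdp_mul2l _ _ _)) dvdp_gcd !gw.
Qed.

Lemma coefM_top (R : nzRingType) d (p q : {poly R}) :
  (size p <= d.+1)%N -> (size q <= d.+1)%N -> (p * q)`_(d + d) = p`_d * q`_d.
Proof.
move=> sp sq; have ltd : (d < (d + d).+1)%N by rewrite ltnS leq_addl.
rewrite coefM (bigD1 (Ordinal ltd)) //= addnK big1 ?addr0 // => -[i /= lti].
rewrite -val_eqE /= neq_ltn => /orP[ltid|ltdi].
  by rewrite [q`__]nth_default ?mulr0 // (leq_trans sq) // ltn_subRL ltn_add2r.
by rewrite nth_default ?mul0r // (leq_trans sp).
Qed.

Section Parametrization.
Variable f : 'I_3 -> {poly L}.
Hypothesis f0 : hesse_cubic a%:P f = 0.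

(** The derivative of a parametrization is tangent to the curve. *)
Lemma tangent_deriv : \sum_i grad f i * (f i)^`() = 0.
Proof.
have /eqP : 3 * (\sum_i grad f i * (f i)^`()) = 0.
  transitivity (hesse_cubic a%:P f)^`(); last by rewrite f0 deriv0.
  rewrite /hesse_cubic sum3E /hesse_grad !ord3E !exprS !expr0.
  by rewrite !(derivD, derivB, derivM, derivC, derivE); ring.
rewrite mulf_eq0 => /orP[|/eqP //]; rewrite -[3]polyC_natr polyC_eq0.
by rewrite (negPf L3).
Qed.

(** The vectors f and f' are both orthogonal to the gradient, so their cross
product, whose entries are the Wronskians, is proportional to the gradient. *)
Lemma wronskian_proportional i j :
  wronskian f i * grad f j = wronskian f j * grad f i.
Proof.
(* an entry of (f x f') x g = f' (f . g) - f (f' . g), for g the gradient *)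
have key k : wronskian f k * grad f (k + 1) = wronskian f (k + 1) * grad f k.
  apply/eqP; rewrite -subr_eq0; apply/eqP.
  transitivity ((f (k + 2))^`() * (\sum_i grad f i * f i)
                - f (k + 2) * (\sum_i grad f i * (f i)^`())).
    by rewrite !sum3E; elim/ord3_ind: k; rewrite !ord3E; ring.
  by rewrite tangent_deriv hesse_euler f0 !mulr0 subr0.
move: j; apply: (@ord3_case i) => //.
by have := key (i + 2); rewrite !ord3D => ->.
Qed.

Hypothesis f_coprime : coprime3 f.

(** By proportionality grad f i divides wronskian f i * grad f k for all k, so
it divides wronskian f i * f j ^+ 4 for all j, since f j ^+ 4 lies in the ideal
of the partial derivatives; finally the f j ^+ 4 are coprime. *)
Lemma hesse_grad_dvd_wronskian i : grad f i %| wronskian f i.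
Proof.
have a3u : 1 - a ^+ 3 != 0 by rewrite subr_eq0 eq_sym.
apply: (dvdp_coprime3 (coprime3_exp 4 f_coprime)) => j.
rewrite -(dvdpZr _ _ a3u) -mul_polyC polyCB polyC1 polyC_exp mulrCA.
rewrite hesse_grad_irrelevant.
have gw k c : grad f i %| wronskian f i * (c * grad f k).
  by rewrite mulrCA wronskian_proportional mulrA dvdp_mulIr.
by do 2!(rewrite mulrDr; apply: dvdp_add; last exact: gw).
Qed.

(** If d is the largest degree of the f j, then some grad f j has degree exactly
2d, because the coefficients of degree d form a nonzero vector, whereas the
Wronskians, which it divides, have degree less than 2d. *)
Lemma coprime_wronskian0 i : wronskian f i = 0.
Proof.
pose n := \max_j size (f j); have sf j : (size (f j) <= n)%N := leq_bigmax j.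
have [n0|n_gt0] := posnP n.
  have fE j : f j = 0 by apply/eqP; rewrite -size_poly_eq0 -leqn0 -n0.
  by rewrite !fE !mul0r subr0.
pose d := n.-1; have nE : n = d.+1 by rewrite prednK.
have [j nj] : exists j, hesse_grad a (fun k => (f k)`_d) j != 0.
  apply/existsP; apply: contraT; rewrite negb_exists => /forallP g0.
  have lc0 : forall k, (f k)`_d = 0.
    by apply: hesse_smooth a3 _ => k; apply/eqP; rewrite -[_ == _]negbK g0.
  have [k _ nk] : {k | k \in predT & \max_j size (f j) = size (f k)}.
    by apply: eq_bigmax_cond; rewrite card_ord.
  have := lc0 k; rewrite /d /n nk -/(lead_coef _) => /eqP.
  by rewrite lead_coef_eq0 -size_poly_eq0 -nk -/n nE.
have sz_grad : (d + d < size (grad f j))%N.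
  rewrite ltnNge; apply: contra nj => /leq_sizeP/(_ _ (leqnn _)) /eqP.
  by rewrite /hesse_grad coefB coefCM expr2 !coefM_top ?expr2 // -nE.
have sz_wronskian : (size (wronskian f j) <= d + d)%N.
  have sz (k l : 'I_3) : (size (f k * (f l)^`())%R <= d + d)%N.
    rewrite (leq_trans (size_polyMleq _ _)) // -subn1 leq_subLR addnA add1n.
    rewrite leq_add // -?nE // -ltnS.
    have [->|nz] := eqVneq (f l) 0; first by rewrite deriv0 size_poly0.
    by rewrite (leq_trans (lt_size_deriv nz)) // -nE.
  by rewrite (leq_trans (size_polyD _ _)) // size_polyN geq_max !sz.
have wj : wronskian f j = 0.
  apply/eqP; apply: contraTT sz_wronskian => nz; rewrite -ltnNge.
  exact: leq_trans sz_grad (dvdp_leq nz (hesse_grad_dvd_wronskian j)).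
have /eqP := wronskian_proportional i j; rewrite wj mul0r mulf_eq0.
by case/orP => /eqP // gj; rewrite gj size_poly0 in sz_grad.
Qed.
End Parametrization.

(** The logarithmic derivatives of the coordinates agree: up to a common factor
a parametrization is constant. Coprimality is achieved by dividing by the gcd,
which multiplies the Wronskians by a square. *)
Theorem hesse_parametrization_constant f : hesse_cubic a%:P f = 0 ->
  forall i j, f i * (f j)^`() = f j * (f i)^`().
Proof.
move=> f0; set r := gcdp (gcdp (f 0) (f 1)) (f 2).
have rf : forall i, r %| f i.
  elim/ord3_ind; rewrite ?dvdp_gcdr // (dvdp_trans (dvdp_gcdl _ _)) //.
    exact: dvdp_gcdl.
  exact: dvdp_gcdr.
have [r0 i j|r_neq0] := eqVneq r 0.
  have fE k : f k = 0 by apply/eqP; rewrite -dvd0p -r0.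
  by rewrite !fE !mul0r.
pose h i := f i %/ r; have fE i : f i = h i * r by rewrite divpK.
have h0 : hesse_cubic a%:P h = 0.
  have /eqP : hesse_cubic a%:P h * r ^+ 3 = 0.
    by rewrite -f0 /hesse_cubic !fE; ring.
  by rewrite mulf_eq0 expf_eq0 (negPf r_neq0) orbF => /eqP.
have h_coprime : coprime3 h.
  rewrite /coprime3 -(eqp_mul2r _ _ r_neq0) mul1r.
  rewrite -(eqp_ltrans (gcdp_mul2r _ _ _)) -(eqp_ltrans (eqp_gcdl _ (gcdp_mul2r _ _ _))).
  by rewrite -!fE eqpxx.
have w0 i : h (i + 1) * (h (i + 2))^`() = h (i + 2) * (h (i + 1))^`().
  by apply/eqP; rewrite -subr_eq0 coprime_wronskian0.
have hh i j : h i * (h j)^`() = h j * (h i)^`().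
  move: j; apply: (@ord3_case i) => [//||]; first by have := w0 (i + 2); rewrite !ord3D.
  by have := w0 (i + 1); rewrite !ord3D.
by move=> i j; rewrite !fE !derivM; ring: (hh i j).
Qed.
End Univariate.

(** * Linear solutions *)

Section Matrix.
Variables (K : fieldType) (a : K).
Hypothesis no_root : forall lambda : K, lambda ^+ 2 + lambda + 1 <> 0.
Hypotheses (a3 : a ^+ 3 != 1) (K2 : 2 != 0 :> K).

(** Here the absence of primitive cube roots of unity comes in. *)
Lemma cube_inj : injective (fun x : K => x ^+ 3).
Proof.
move=> x y /= xy; have [y0|y_neq0] := eqVneq y 0.
  by move/eqP: xy; rewrite y0 expr0n expf_eq0 => /eqP.
have /eqP : (x - y) * (y ^+ 2 * ((x / y) ^+ 2 + x / y + 1)) = 0.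
  have -> : y ^+ 2 * ((x / y) ^+ 2 + x / y + 1) = x ^+ 2 + x * y + y ^+ 2 by field.
  by ring: xy.
have y2 : y ^+ 2 != 0 by rewrite expf_neq0.
rewrite mulf_eq0 mulf_eq0 (negPf y2) subr_eq0 => /orP[/eqP //|/eqP].
by move/no_root.
Qed.

Variable A : 'I_3 -> 'I_3 -> K.
Hypothesis col_neq0 : forall k, exists i, A i k != 0.
Hypothesis mixed : forall i k,
  A i (k + 1) * A i (k + 2) = a * (A (i + 1) (k + 2) * A (i + 2) (k + 1)).
Hypothesis square : forall i k,
  A (i + 1) (k + 1) * A (i + 2) (k + 2) - A (i + 1) (k + 2) * A (i + 2) (k + 1)
  = A i k ^+ 2 - a * (A (i + 1) k * A (i + 2) k).

(* B s runs along the s-th cyclic diagonal of A; the matrices to be found are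
   those with a single nonzero diagonal, which is constant. *)
Let B (s i : 'I_3) : K := A i (i + s).

Let BE s i : (B (s + 1) (i + 1) = A (i + 1) (i + s + 2)) *
  (B (s + 2) (i + 1) = A (i + 1) (i + s)) * (B s (i + 1) = A (i + 1) (i + s + 1)) *
  (B (s + 1) (i + 2) = A (i + 2) (i + s)) *
  (B (s + 2) (i + 2) = A (i + 2) (i + s + 1)) * (B s (i + 2) = A (i + 2) (i + s + 2)).
Proof.
by do !split; congr (A _ _); apply: val_inj; elim/ord3_ind: i; elim/ord3_ind: s.
Qed.

Let mixedB s i : B s i * B (s + 1) i = a * (B s (i + 1) * B (s + 1) (i + 2)).
Proof. by have := mixed i (i + s + 2); rewrite !BE !ord3D /B [i + (s + 1)]addrA. Qed.

Let squareB s i : B s (i + 1) * B s (i + 2) - B (s + 1) (i + 1) * B (s + 2) (i + 2)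
  = B s i ^+ 2 - a * (B (s + 2) (i + 1) * B (s + 1) (i + 2)).
Proof. by have := square i (i + s); rewrite !(BE s i). Qed.

(** Multiplying the three equations [mixedB s] gives P = a ^+ 3 * P for the
product P of the entries of two diagonals. *)
Let B_disjoint s : (forall i, B s i != 0) -> ~ (forall i, B (s + 1) i != 0).
Proof.
move=> p q; pose P := B s 0 * B s 1 * B s 2 * (B (s + 1) 0 * B (s + 1) 1 * B (s + 1) 2).
have : (1 - a ^+ 3) * P = 0.
  have := (mixedB s 0, mixedB s 1, mixedB s 2); rewrite !ord3E => -[[m0 m1] m2].
  transitivity (P - (a * (B s 1 * B (s + 1) 2)) * (a * (B s 2 * B (s + 1) 0))
     * (a * (B s 0 * B (s + 1) 1))); first by rewrite /P; ring.
  by rewrite -m0 -m1 -m2 /P; ring.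
apply/eqP; apply: mulf_neq0; first by rewrite subr_eq0 eq_sym.
by rewrite /P !mulf_neq0.
Qed.

(** When a = 0 each row has at most one nonzero entry. If the nonzero entries
did not all lie on one diagonal, the matrix would be a transposition up to
scaling of the rows; its entries b, c, d satisfy b ^+ 2 = - (c * d) and so on,
so they have the same cube and are equal, whence b ^+ 2 = - b ^+ 2. *)
Let B_neq0_a0 s i : a = 0 -> B s i != 0 -> forall j, B s j != 0.
Proof.
move=> a0 Bi.
have row0 t j : B t j * B (t + 1) j = 0 by rewrite mixedB a0 mul0r.
have B1 : B (s + 1) i = 0.
  by have /eqP := row0 s i; rewrite mulf_eq0 (negPf Bi) => /eqP.
have B2 : B (s + 2) i = 0.
  have /eqP := row0 (s + 2) i; rewrite ord3D mulf_eq0 (negPf Bi) orbF.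
  by move/eqP.
have [/eqP z|nz] := boolP (B s (i + 1) * B s (i + 2) == 0); last first.
  move: nz; rewrite mulf_eq0 negb_or => /andP[nz1 nz2].
  exact: (@ord3_case i).
have sq t j :
    B t j ^+ 2 = B t (j + 1) * B t (j + 2) - B (t + 1) (j + 1) * B (t + 2) (j + 2).
  by rewrite squareB a0 mul0r subr0.
have := (sq s i, sq (s + 1) (i + 1), sq (s + 2) (i + 2)).
rewrite !ord3D z B1 B2 ?mulr0 ?mul0r !sub0r => -[[]].
set b := B s i; set c := B _ _; set d := B _ _ => eb ec ed.
have bc : b = c by apply: cube_inj; rewrite /= !exprS expr0 !mulr1 -!expr2 eb ec; ring.
have bd : b = d by apply: cube_inj; rewrite /= !exprS expr0 !mulr1 -!expr2 eb ed; ring.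
have /eqP : 2 * b ^+ 2 = 0 by rewrite mulr_natl mulr2n {1}eb -bc -bd; ring.
by rewrite mulf_eq0 expf_eq0 (negPf K2) (negPf Bi).
Qed.

(** When a != 0, a zero on the diagonal s spreads along it by the equations that
link this diagonal to the next one and to the previous one, unless both of these
vanish at the entries in the same column, which would then be zero. *)
Let B_eq0 s i : B s i = 0 -> forall j, B s j = 0.
Proof.
move=> Bi; have [a0 j|a_neq0] := eqVneq a 0.
  by apply: contraTeq isT => /(B_neq0_a0 a0) /(_ i); rewrite Bi eqxx.
have pq j := mixedB s j; have rp j := mixedB (s + 2) j.
have [q0|q_neq0] := eqVneq (B (s + 1) (i + 2)) 0; last first.
  apply: (@ord3_case i) => //.
    have /eqP := pq i; rewrite Bi mul0r eq_sym !mulf_eq0 (negPf a_neq0).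
    by rewrite (negPf q_neq0) orbF => /eqP.
  have /eqP := pq (i + 2); rewrite !ord3D Bi mul0r mulr0 mulf_eq0.
  by rewrite (negPf q_neq0) orbF => /eqP.
have [r0|r_neq0] := eqVneq (B (s + 2) (i + 1)) 0; last first.
  apply: (@ord3_case i) => //.
    have /eqP := rp (i + 1); rewrite !ord3D Bi !mulr0 mulf_eq0.
    by rewrite (negPf r_neq0) => /eqP.
  have /eqP := rp i; rewrite !ord3D Bi mulr0 eq_sym !mulf_eq0 (negPf a_neq0).
  by rewrite (negPf r_neq0) => /eqP.
have [j] := col_neq0 (i + s); case/eqP; move: j; apply: (@ord3_case i) => //.
  by rewrite -r0 BE.
by rewrite -q0 BE.
Qed.

(** The equations are those for the matrix of a linear solution of the
relations: [square] comes from the coefficients of the X_k ^+ 2, and [mixed]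
from those of the X_(k+1) * X_(k+2). Each diagonal is entirely zero or has no
zero, and exactly one is nonzero; on it [square] says that b_k ^+ 3 is the product
of the entries for every k. *)
Lemma hesse_matrix_cyclic : exists2 c, c != 0 &
  exists s, forall i j, A i j = if j == i + s then c else 0.
Proof.
have [i0 nz] := col_neq0 0; pose s := - i0.
have Bs_neq0 i : B s i != 0.
  apply: contra nz => /eqP /B_eq0 /(_ i0) <-.
  by rewrite /B subrr.
have B0 t i : t != s -> B t i = 0.
  move=> ts; apply/eqP; apply: contraT => nzt.
  have Bt_neq0 j : B t j != 0 by apply: contra nzt => /eqP /B_eq0 ->.
  move: t {nzt} ts Bt_neq0; apply: (@ord3_case s) => [|_ |_ B2]; first by rewrite eqxx.
    by move/(B_disjoint Bs_neq0).
  by have := B_disjoint B2; rewrite ord3D; case.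
exists (B s 0) => //; exists s => i j; have -> : A i j = B (j - i) i.
  by rewrite /B addrC subrK.
have [->|ne] := eqVneq; last by rewrite B0 // subr_eq addrC.
rewrite addrAC subrr add0r; apply: cube_inj => /=.
have cube k : B s k ^+ 3 = B s 0 * B s 1 * B s 2.
  have s1 : s + 1 != s by elim/ord3_ind: (s).
  have s2 : s + 2 != s by elim/ord3_ind: (s).
  have := squareB s k; rewrite !(B0 _ _ s1) !(B0 _ _ s2) !(mul0r, mulr0, subr0).
  by move=> e; rewrite exprS -e; elim/ord3_ind: k {e}; rewrite !ord3E; ring.
by rewrite !cube.
Qed.
End Matrix.

(** * Derivations and homogeneous parts of multivariate polynomials *)

Lemma mpoly_ring_ind n (R : comNzRingType) (P : {mpoly R[n]} -> Prop) :
  (forall c, P c%:MP) -> (forall i, P 'X_i) ->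
  (forall u v, P u -> P v -> P (u + v)) ->
  (forall u v, P u -> P v -> P (u * v)) -> forall u, P u.
Proof.
move=> PC PX PD PM; elim/mpolyind=> [|c m u _ _ Pu]; first by rewrite -mpolyC0.
apply: PD Pu; rewrite -mul_mpolyC mpolyXE_id; apply: (PM _ _ (PC c)).
apply: big_ind => // [|i _]; first by rewrite -mpolyC1.
by elim: (m i) => [|k IHk]; [rewrite expr0 -mpolyC1|rewrite exprS; apply: PM].
Qed.

(** Stated for any derivation D of the target, so as to cover the partial
derivatives after an endomorphism of the polynomial ring as well as the Taylor
expansion along an axis. *)
Lemma chain_rule n (K A : comNzRingType) (f : {rmorphism {mpoly K[n]} -> A})
    (D : {additive A -> A}) :
  (forall x y, D (x * y) = D x * y + x * D y) -> (forall c, D (f c%:MP) = 0) ->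
  forall u, D (f u) = \sum_i f u^`M(i) * D (f 'X_i).
Proof.
move=> DM DC; elim/mpoly_ring_ind=> [c|i|u v IHu IHv|u v IHu IHv].
- by rewrite DC big1 // => i _; rewrite mderivC rmorph0 mul0r.
- rewrite (bigD1 i) //= big1 ?addr0 => [|j /negPf ji].
    have UU : (U_(i) - U_(i) = 0)%MM by apply/mnmP => j; rewrite mnmBE subnn mnm0E.
    by rewrite mderivX mnm1E eqxx UU mpolyX0 scale1r rmorph1 mul1r.
  by rewrite mderivX mnm1E eq_sym ji scale0r rmorph0 mul0r.
- rewrite !rmorphD raddfD IHu IHv -big_split; apply: eq_bigr => i _ /=.
  by rewrite mderivD rmorphD mulrDl.
rewrite rmorphM DM IHu IHv mulr_suml mulr_sumr -big_split.
by apply: eq_bigr => i _ /=; rewrite mderivM rmorphD !rmorphM; ring.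
Qed.

Section Homogeneous.
Variables (n : nat) (R : idomainType).
Implicit Types p q : {mpoly R[n]}.

Lemma mcoeff_pihomog d p m :
  (pihomog mdeg d p)@_m = if mdeg m == d then p@_m else 0.
Proof.
rewrite /pihomog raddf_sum /= [in RHS](mpolyE p) raddf_sum /= big_mkcond.
case: ifP => [/eqP md|md].
  apply: eq_bigr => k _; case: ifP => // kd; rewrite mcoeffZ mcoeffX.
  case: eqP => [km|_]; last by rewrite mulr0.
  by rewrite km md eqxx in kd.
apply: big1 => k _; case: ifP => // kd; rewrite mcoeffZ mcoeffX.
case: eqP => [km|_]; last by rewrite mulr0.
by rewrite -km kd in md.
Qed.

Lemma pihomog_deriv d p i : (pihomog mdeg d.+1 p)^`M(i) = pihomog mdeg d p^`M(i).
Proof.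
apply/mpolyP => m; rewrite mcoeff_deriv !mcoeff_pihomog mcoeff_deriv.
by rewrite mdegD mdeg1 addn1 eqSS; case: ifP; rewrite ?mul0rn.
Qed.

Lemma pihomog_gt d p : (msize p <= d)%N -> pihomog mdeg d p = 0.
Proof.
move=> sp; apply/mpolyP => m; rewrite mcoeff_pihomog mcoeff0.
case: eqP => // md; apply: memN_msupp_eq0; apply: msize_mdeg_ge.
by rewrite md.
Qed.

Lemma msize_sub_pihomog d p : (msize p <= d.+1)%N ->
  (msize (p - pihomog mdeg d p) <= d)%N.
Proof.
move=> sp; rewrite msizeE; apply/bigmax_leqP_seq => m + _.
rewrite mcoeff_msupp mcoeffB mcoeff_pihomog; case: (mdeg m =P d) => [_|/eqP md].
  by rewrite subrr eqxx.
rewrite subr0 -mcoeff_msupp => /msize_mdeg_lt /leq_trans /(_ sp).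
by rewrite ltnS leq_eqVlt (negPf md).
Qed.

Lemma msize_pihomog d p : (msize (pihomog mdeg d p) <= d.+1)%N.
Proof.
rewrite msizeE; apply/bigmax_leqP_seq => m + _.
by rewrite mcoeff_msupp mcoeff_pihomog; case: (mdeg m =P d) => [->|]; rewrite ?eqxx.
Qed.

Lemma msizeM_leq d e p q :
  (msize p <= d)%N -> (msize q <= e)%N -> (msize (p * q) <= (d + e).-1)%N.
Proof.
move=> sp sq; have [->|p0] := eqVneq p 0; first by rewrite mul0r msize0.
have [->|q0] := eqVneq q 0; first by rewrite mulr0 msize0.
by rewrite msizeM // -!subn1 leq_sub2r // leq_add.
Qed.

(** Leading parts multiply; the degree bounds need not be attained, so the parts
may be zero. *)
Lemma pihomogM d e p q : (msize p <= d.+1)%N -> (msize q <= e.+1)%N ->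
  pihomog mdeg (d + e) (p * q) = pihomog mdeg d p * pihomog mdeg e q.
Proof.
move=> sp sq; set p' := pihomog mdeg d p; set q' := pihomog mdeg e q.
have -> : p * q = p' * q' + (p' * (q - q') + (p - p') * q) by ring.
rewrite !pihomogD pihomog_dE; last by apply: dhomogM; apply: pihomogP.
rewrite !pihomog_gt ?addr0 //.
  by have := msizeM_leq (msize_sub_pihomog sp) sq; rewrite addnS.
by have := msizeM_leq (msize_pihomog d p) (msize_sub_pihomog sq).
Qed.

Lemma msize_deriv d p i : (msize p <= d.+1)%N -> (msize p^`M(i) <= d)%N.
Proof.
move=> sp; rewrite msizeE; apply/bigmax_leqP_seq => m + _.
rewrite mcoeff_msupp mcoeff_deriv => nz.
have : (m + U_(i))%MM \in msupp p.
  by rewrite mcoeff_msupp; apply: contra nz => /eqP ->; rewrite mul0rn.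
by move/msize_mdeg_lt; rewrite mdegD mdeg1 addn1 => /leq_trans /(_ sp).
Qed.

Lemma mderiv0_const p : [pchar R] =i pred0 ->
  (forall i, p^`M(i) = 0) -> p = (p@_0%MM)%:MP.
Proof.
move=> /pcharf0P ch p'0; apply/mpolyP => m; rewrite mcoeffC.
have [->|nz] := eqVneq m 0%MM; first by rewrite mulr1.
rewrite mulr0; have [i mi] : exists i, m i != 0%N.
  apply/existsP; apply: contraNT nz; rewrite negb_exists => /forallP m0.
  by apply/eqP/mnmP => i; rewrite mnm0E; apply/eqP; rewrite -[_ == _]negbK m0.
have := congr1 (mcoeff (m - U_(i))%MM) (p'0 i); rewrite mcoeff_deriv mcoeff0.
rewrite submK; last by rewrite lep1mP.
by move/eqP; rewrite -mulr_natr mulf_eq0 ch orbF => /eqP.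
Qed.

Lemma mpoly_unit_const p q : p * q = 1 -> exists2 c, c != 0 & p = c%:MP.
Proof.
move=> pq; have : q * p = 1 by rewrite mulrC.
case/mpoly_intro_unit/andP=> /eqP pE u; exists p@_0%MM => //.
by apply: contraTneq u => ->; rewrite unitr0.
Qed.

Lemma mpoly_linear p :
  (msize p <= 2)%N -> p@_0%MM = 0 -> p = \sum_i p@_U_(i) *: 'X_i.
Proof.
move=> sp p0; apply/mpolyP => m; rewrite raddf_sum /=.
have [->|m0] := eqVneq m 0%MM.
  rewrite p0 big1 // => i _; rewrite mcoeffZ mcoeffX.
  by rewrite -mdeg_eq0 mdeg1 mulr0.
have [/mdeg1P[i /eqP ->]|m1] := boolP (mdeg m == 1%N).
  rewrite (bigD1 i) //= big1 ?addr0 => [|j ji].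
    by rewrite mcoeffZ mcoeffX eqxx mulr1.
  rewrite mcoeffZ mcoeffXU (negPf ji) mulr0 //.
rewrite big1 => [|i _]; last first.
  rewrite mcoeffZ mcoeffX; case: eqP => [mi|]; last by rewrite mulr0.
  by rewrite -mi mdeg1 in m1.
apply: memN_msupp_eq0; apply: msize_mdeg_ge; apply: leq_trans sp _.
by case: (mdeg m) (mdeg_eq0 m) m1 => [|[|//]]; rewrite ?eqxx ?(negPf m0).
Qed.

End Homogeneous.

(** * Triples satisfying the elliptic bracket relations *)

Section Relations.
Variables (K : fieldType) (alpha : K).
Hypothesis charK : [pchar K] =i pred0.
Hypothesis alpha3 : alpha ^+ 3 != 1.
Local Notation P := {mpoly K[3]}.
Local Notation br := (elliptic_bracket alpha).
Local Notation cubic := (hesse_cubic (alpha%:MP : P)).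
Local Notation grad := (hesse_grad (alpha%:MP : P)).
Local Notation X := (fun i : 'I_3 => 'X_i : P).
Implicit Types (u v : P) (F G : 'I_3 -> P).

Lemma natr_neq0 n : n.+1%:R != 0 :> K.
Proof. by have /pcharf0P -> := charK. Qed.

Lemma natrP_neq0 n : n.+1%:R != 0 :> P.
Proof. by rewrite -mpolyC_nat mpolyC_eq0 natr_neq0. Qed.

Lemma alphaP3 : (alpha%:MP : P) ^+ 3 != 1.
Proof. by rewrite -rmorphXn -mpolyC1 mpolyC_eq. Qed.

Lemma deriv_potential k : (elliptic_potential alpha)^`M(k) = grad X k.
Proof.
have third3 : (3^-1 : K)%:MP * 3 = 1 :> P.
  by rewrite -[3 in X in _ * X]mpolyC_nat -mpolyCM mulVf ?mpolyC1 ?natr_neq0.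
rewrite /elliptic_potential -!mul_mpolyC /hesse_grad !exprS expr0 /vx /vy /vz.
rewrite !(mderivD, mderivN, mderivM, mderivC, mderiv_var).
by elim/ord3_ind: k; rewrite !ord3E /=; ring: third3.
Qed.

Lemma elliptic_bracketE u v : br u v =
  \sum_k grad X k * (u^`M(k + 1) * v^`M(k + 2) - u^`M(k + 2) * v^`M(k + 1)).
Proof. by rewrite /= jacobianE !deriv_potential sum3E !ord3E; ring. Qed.

Definition hesse_relations F := forall i, br (F (i + 1)) (F (i + 2)) = grad F i.

Lemma hesse_relationsX : hesse_relations X.
Proof.
move=> i; rewrite elliptic_bracketE sum3E !mderiv_var.
by elim/ord3_ind: i; rewrite !ord3E /=; ring.
Qed.

Lemma jacobian_rmorphism (f : {rmorphism P -> P}) u v w :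
  (forall c, f c%:MP = c%:MP) ->
  jacobian (f u) (f v) (f w) = f (jacobian u v w) * jacobian (f 'X_0) (f 'X_1) (f 'X_2).
Proof.
move=> fC; have fE t k : (f t)^`M(k) = \sum_i f t^`M(i) * (f 'X_i)^`M(k).
  apply: (chain_rule (D := mderiv k)) => [x y|c]; first exact: mderivM.
  by rewrite /= fC mderivC.
rewrite !jacobianE !(fE u) !(fE v) !(fE w) !sum3E.
by rewrite !(rmorphD, rmorphB, rmorphM); ring.
Qed.

Lemma deriv_cubic F k : (cubic F)^`M(k) = 3 * \sum_i grad F i * (F i)^`M(k).
Proof.
rewrite /hesse_cubic sum3E /hesse_grad !exprS !expr0 !ord3E.
rewrite !(mderivD, mderivN, mderivM, mderivC).
ring.
Qed.

(** With D the Jacobian matrix of F, the relations say that Cof(D) (grad C) is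
(grad C)(F); multiplying by the transpose of D turns Cof(D) into det D. *)
Lemma deriv_cubic_relations F k : hesse_relations F ->
  (cubic F)^`M(k) = 3 * (jacobian (F 0) (F 1) (F 2) * grad X k).
Proof.
move=> rF; rewrite deriv_cubic; congr (3 * _).
under eq_bigr => i _ do rewrite -rF elliptic_bracketE.
rewrite jacobianE !sum3E.
move: (grad X) => g; elim/ord3_ind: k; rewrite !ord3E; ring.
Qed.

(* The several-variable statement follows from the univariate one by expanding
   F (X + t e_k) in powers of t over a field L containing the polynomial ring:
   the derivative with respect to t at t = 0 is the k-th partial derivative. *)
Section Taylor.
Variables (L : fieldType) (iota : {rmorphism P -> L}) (k : 'I_3).

Let taylor_const : {rmorphism K -> {poly L}} := polyC \o iota \o (@mpolyC 3 K).
Let taylor_var (i : 'I_3) : {poly L} := (iota 'X_i)%:P + (i == k)%:R *: 'X.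
Let taylor : {rmorphism P -> {poly L}} := mmap taylor_const taylor_var.

Let taylorC c : taylor c%:MP = (iota c%:MP)%:P.
Proof. by rewrite /taylor /= mmapC. Qed.

Let taylorX i : taylor 'X_i = taylor_var i.
Proof. by rewrite /taylor /= mmapX mmap1U. Qed.

Let taylor_deriv u : (taylor u)^`() = taylor u^`M(k).
Proof.
have := chain_rule (f := taylor) (D := @deriv L) _ _ u => /= ->.
- rewrite (bigD1 k) //= big1 ?addr0 => [|i /negPf ik]; rewrite taylorX.
    by rewrite /taylor_var eqxx derivD derivC derivZ derivX scale1r add0r mulr1.
  by rewrite /taylor_var ik derivD derivC derivZ derivX scale0r addr0 mulr0.
- by move=> x y /=; rewrite derivM.
by move=> c; rewrite taylorC derivC.
Qed.

Let taylor0 u : (taylor u).[0] = iota u.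
Proof.
elim/mpoly_ring_ind: u => [c|i|u v IHu IHv|u v IHu IHv].
- by rewrite taylorC hornerC.
- by rewrite taylorX !hornerE.
- by rewrite !rmorphD hornerD IHu IHv.
by rewrite !rmorphM hornerM IHu IHv.
Qed.

Lemma cubic0_proportional_in F : injective iota -> cubic F = 0 ->
  forall i j, F i * (F j)^`M(k) = F j * (F i)^`M(k).
Proof.
move=> iota_inj F0 i j; apply: (iota_inj); rewrite !rmorphM -!taylor0 -!hornerM.
rewrite -!taylor_deriv; congr (_.[0]).
apply: (@hesse_parametrization_constant _ (iota alpha%:MP) _ _ (fun i => taylor (F i))).
- by rewrite -rmorphXn -(rmorph1 iota) (inj_eq iota_inj) alphaP3.
- by rewrite -(rmorph_nat iota 3) -(rmorph0 iota) (inj_eq iota_inj) natrP_neq0.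
transitivity (taylor (cubic F)); last by rewrite F0 rmorph0.
rewrite -taylorC /hesse_cubic.
by rewrite rmorphB !rmorphD !rmorphXn !rmorphM rmorph_nat.
Qed.
End Taylor.

Lemma cubic0_proportional F : cubic F = 0 ->
  forall k i j, F i * (F j)^`M(k) = F j * (F i)^`M(k).
Proof.
move=> F0 k; apply: (@cubic0_proportional_in {fraction P} (@tofrac P)) => //.
by move=> u v /eqP; rewrite tofrac_eq => /eqP.
Qed.

(** As the F i are proportional to their derivatives, F (i + 1) times the
bracket of F (i + 1) and F (i + 2) is zero; so all the brackets vanish, and by
the relations they form the gradient at F. *)
Lemma isotropic_relations F : hesse_relations F -> cubic F = 0 -> forall i, F i = 0.
Proof.
move=> rF F0; apply: (hesse_smooth alphaP3) => i; rewrite -rF.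
have /eqP : F (i + 1) * br (F (i + 1)) (F (i + 2)) = 0.
  rewrite elliptic_bracketE mulr_sumr big1 // => k _.
  have := (cubic0_proportional F0 (k + 1) (i + 1) (i + 2),
           cubic0_proportional F0 (k + 2) (i + 1) (i + 2)).
  move=> -[e1 e2]; rewrite mulrCA mulrBr [F _ * (_ * _)]mulrCA e2.
  by rewrite [F _ * (_ * (F (i + 2))^`M(_))]mulrCA e1; ring.
rewrite mulf_eq0 => /orP[/eqP -> |/eqP //].
by rewrite elliptic_bracketE big1 // => k _; rewrite !mderiv0 !mul0r subrr mulr0.
Qed.
End Relations.

(** * Triples satisfying the relations are linear *)

Section Degree.
Variables (K : fieldType) (alpha : K).
Hypothesis charK : [pchar K] =i pred0.
Hypothesis alpha3 : alpha ^+ 3 != 1.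
Local Notation P := {mpoly K[3]}.
Local Notation br := (elliptic_bracket alpha).
Local Notation cubic := (hesse_cubic (alpha%:MP : P)).
Local Notation grad := (hesse_grad (alpha%:MP : P)).
Local Notation X := (fun i : 'I_3 => 'X_i : P).
Implicit Types (u v : P) (F G : 'I_3 -> P).
Local Notation top d := (fun F i => pihomog mdeg d (F i)).

Lemma gradX_homog k : grad X k \is 2.-homog.
Proof.
rewrite /hesse_grad expr2 mul_mpolyC rpredB ?rpredZ //.
  by rewrite (dhomogM (d := 1) (e := 1)) // dhomogX /= mdeg1.
by rewrite (dhomogM (d := 1) (e := 1)) // dhomogX /= mdeg1.
Qed.

Lemma msize_gradX k : (msize (grad X k) <= 3)%N.
Proof. by rewrite -(pihomog_dE (gradX_homog k)) msize_pihomog. Qed.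

Lemma msizeB_leq d u v :
  (msize u <= d)%N -> (msize v <= d)%N -> (msize (u - v) <= d)%N.
Proof.
move=> su sv; rewrite (leq_trans (msizeD_le _ _)) // geq_max msizeN.
by rewrite su sv.
Qed.

(** The bracket is homogeneous of degree 0: differentiating twice is compensated
by the quadratic gradient of the potential. *)
Lemma pihomog_bracket d u v : (msize u <= d.+2)%N -> (msize v <= d.+2)%N ->
  pihomog mdeg (d.+1 + d.+1) (br u v) = br (pihomog mdeg d.+1 u) (pihomog mdeg d.+1 v).
Proof.
move=> su sv; rewrite (_ : d.+1 + d.+1 = 2 + (d + d))%N; last by rewrite addSn addnS.
have s' (w : P) i : (msize w <= d.+2)%N -> (msize w^`M(i) <= d.+1)%N.
  exact: msize_deriv.
have sM i j : (msize (u^`M(i) * v^`M(j)) <= (d + d).+1)%N.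
  by have := msizeM_leq (s' u i su) (s' v j sv); rewrite addSn addnS.
rewrite !elliptic_bracketE // raddf_sum; apply: eq_bigr => k _ /=.
rewrite pihomogM ?msize_gradX ?msizeB_leq // (pihomog_dE (gradX_homog k)).
by rewrite pihomogB !pihomogM ?s' // !pihomog_deriv.
Qed.

Lemma pihomog_grad d F i : (forall j, msize (F j) <= d.+1)%N ->
  pihomog mdeg (d + d) (grad F i) = grad (top d F) i.
Proof.
by move=> sF; rewrite /hesse_grad !mul_mpolyC pihomogB linearZ /= expr2 !pihomogM.
Qed.

Lemma pihomog_cubic d F : (forall j, msize (F j) <= d.+1)%N ->
  pihomog mdeg (d + d + d) (cubic F) = cubic (top d F).
Proof.
move=> sF; rewrite -!hesse_euler raddf_sum; apply: eq_bigr => i _ /=.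
rewrite pihomogM ?pihomog_grad // /hesse_grad mul_mpolyC.
have sM j k : (msize (F j * F k) <= (d + d).+1)%N.
  by have := msizeM_leq (sF j) (sF k); rewrite addSn addnS.
by rewrite expr2 msizeB_leq // (leq_trans (msizeZ_le _ _)).
Qed.

(** The parts G of degree d + 2 satisfy the relations as well, and their cubic
vanishes: it is the part of degree 3 (d + 2) of the cubic of F, whose gradient
is a constant times the quadratic gradient of the potential. So G = 0. *)
Lemma relations_degree_drop d c F : hesse_relations alpha F ->
  jacobian (F 0) (F 1) (F 2) = c%:MP -> (forall i, msize (F i) <= d.+3)%N ->
  forall i, (msize (F i) <= d.+2)%N.
Proof.
move=> rF jF sF; pose G := top d.+2 F.
have rG : hesse_relations alpha G.
  by move=> i; rewrite -pihomog_grad // -rF pihomog_bracket.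
have cG : cubic G = 0.
  rewrite -pihomog_cubic // !addnS /=; set C := pihomog mdeg _ _.
  have C0 i : C^`M(i) = 0.
    rewrite /C pihomog_deriv deriv_cubic_relations // jF pihomog_gt //.
    rewrite mulr_natl mul_mpolyC -scaler_nat (leq_trans (msizeZ_le _ _)) //.
    by rewrite (leq_trans (msizeZ_le _ _)) // (leq_trans (msize_gradX _)).
  rewrite (mderiv0_const charK C0) /C mcoeff_pihomog mdeg0 /=.
  exact: mpolyC0.
have G0 := isotropic_relations charK alpha3 rG cG.
by move=> i; have := msize_sub_pihomog (sF i); rewrite -/(G i) G0 subr0.
Qed.

Lemma relations_affine c F : hesse_relations alpha F ->
  jacobian (F 0) (F 1) (F 2) = c%:MP -> forall i, (msize (F i) <= 2)%N.
Proof.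
move=> rF jF; have [d] : exists d, (forall i, msize (F i) <= d.+2)%N.
  exists (\max_i msize (F i)) => i; do 2!apply: leqW.
  exact: (leq_bigmax (F := fun i => msize (F i))).
by elim: d => // d IHd /(relations_degree_drop rF jF).
Qed.

(** Evaluate the relations at the origin, where the gradient of the potential
vanishes and with it every bracket. *)
Lemma relations_const0 F : hesse_relations alpha F -> forall i, (F i)@_0%MM = 0.
Proof.
move=> rF; apply: (hesse_smooth alpha3) => i.
have -> : hesse_grad alpha (fun j => (F j)@_0%MM) i = (grad F i)@_0%MM.
  by rewrite /hesse_grad mul_mpolyC mcoeffB mcoeffZ expr2 !rmorphM.
rewrite -rF elliptic_bracketE // raddf_sum big1 // => k _ /=.
rewrite rmorphM /= (dhomog_nemf_coeff (gradX_homog k)) ?mul0r //.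
by rewrite /= mdeg0.
Qed.

(** The coefficients in the relations between linear forms are read off by
evaluating at the unit vector of index k, and at the sum of the other two. *)
Lemma relations_cyclic c F :
  (forall lambda : K, lambda ^+ 2 + lambda + 1 <> 0) ->
  hesse_relations alpha F ->
  jacobian (F 0) (F 1) (F 2) = c%:MP -> c != 0 ->
  exists2 b, b != 0 & exists s, forall i, F i = b *: 'X_(i + s).
Proof.
move=> no_root rF jF c0.
have [A FE] : exists A : 'I_3 -> 'I_3 -> K,
    forall i, F i = \sum_k A i k *: 'X_k.
  exists (fun i k => (F i)@_U_(k)) => i.
  by apply: mpoly_linear; [apply: relations_affine jF _ | apply: relations_const0].
have dF i k : (F i)^`M(k) = (A i k)%:MP.
  rewrite FE raddf_sum (bigD1 k) //= big1 ?addr0 => [|j /negPf jk].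
    by rewrite mderivZ mderiv_var eqxx -mul_mpolyC mulr1.
  by rewrite mderivZ mderiv_var jk scaler0.
have ev (v : 'I_3 -> K) i :
    \sum_k hesse_grad alpha v k * (A (i + 1) (k + 1) * A (i + 2) (k + 2)
                                   - A (i + 1) (k + 2) * A (i + 2) (k + 1))
    = hesse_grad alpha (fun j => \sum_k A j k * v k) i.
  have := congr1 (meval v) (rF i).
  have mF j : (F j).@[v] = \sum_k A j k * v k.
    rewrite FE raddf_sum /=; apply: eq_bigr => k _.
    by rewrite mevalZ mevalXU.
  have mC t : (t%:MP : P).@[v] = t by exact: mevalC.
  have dFv j k : (F j)^`M(k).@[v] = A j k by rewrite dF mC.
  have mG H k : (grad H k).@[v] = hesse_grad alpha (fun j => (H j).@[v]) k.
    by rewrite /hesse_grad mul_mpolyC mevalB mevalZ expr2 !mevalM.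
  rewrite mG /hesse_grad !mF => <-; rewrite elliptic_bracketE // raddf_sum /=.
  apply: eq_bigr => k _; have mX : (grad X k).@[v] = hesse_grad alpha v k.
    by rewrite mG /hesse_grad !mevalXU.
  by rewrite mevalM mX mevalB; congr (_ * (_ - _)); rewrite mevalM !dFv.
have square i k : A (i + 1) (k + 1) * A (i + 2) (k + 2)
    - A (i + 1) (k + 2) * A (i + 2) (k + 1)
  = A i k ^+ 2 - alpha * (A (i + 1) k * A (i + 2) k).
  have := ev (fun j => if j == k then 1 else 0) i; rewrite /hesse_grad !(sum3E_from _ k).
  rewrite /= !ord3D !eqxx !ord3_neq => e; apply: (eq_lin e); clear e.
  repeat match goal with |- context [A ?j ?l] => move: (A j l) => ? end.
  ring.
have mixed i k : A i (k + 1) * A i (k + 2) =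
    alpha * (A (i + 1) (k + 2) * A (i + 2) (k + 1)).
  pose v j : K := if j == k then 0 else 1.
  have : 2 * (A i (k + 1) * A i (k + 2)
         - alpha * (A (i + 1) (k + 2) * A (i + 2) (k + 1))) = 0.
    move: (ev v i) (square i (k + 1)) (square i (k + 2)).
    rewrite /hesse_grad !(sum3E_from _ k) !ord3D /v eqxx !ord3_neq /=.
    move=> e s1 s2; apply: (eq_lin (esym e)); apply: (eq_lin s1).
    apply: (eq_lin s2); clear e s1 s2.
    repeat match goal with |- context [A ?j ?l] => move: (A j l) => ? end.
    ring.
  move/eqP; rewrite mulf_eq0 (negPf (natr_neq0 charK 1)) subr_eq0.
  by move/eqP.
have col_neq0 k : exists i, A i k != 0.
  apply/existsP; apply: contraNT c0; rewrite negb_exists => /forallP A0.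
  have Ak i : A i k = 0 by apply/eqP; rewrite -[_ == _]negbK A0.
  rewrite -(mpolyC_eq0 3) -jF jacobianE !dF.
  by elim/ord3_ind: k {A0} Ak => Ak; rewrite !Ak mpolyC0; apply/eqP; ring.
have [b b0 [s AE]] :=
  hesse_matrix_cyclic no_root alpha3 (natr_neq0 charK 1) col_neq0 mixed square.
exists b => //; exists s => i; rewrite FE (bigD1 (i + s)) //= AE eqxx big1 ?addr0 //.
by move=> j /negPf js; rewrite AE js scale0r.
Qed.
End Degree.

(** * Automorphisms *)

Section Automorphisms.
Variables (K : fieldType) (alpha : K).
Hypothesis charK : [pchar K] =i pred0.
Local Notation P := {mpoly K[3]}.
Local Notation br := (elliptic_bracket alpha).
Local Notation grad := (hesse_grad (alpha%:MP : P)).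
Local Notation X := (fun i : 'I_3 => 'X_i : P).
Implicit Types (u v : P) (c : units K) (s : 'I_3).

Lemma poisson_aut1 (f : poissonAut br) : f 1 = 1.
Proof.
have [[g gK fK] _ fM _] := poissonAutP f.
by rewrite -[LHS]mulr1 -{2}(fK 1) -fM mul1r fK.
Qed.

Lemma poisson_aut_rmorphism (f : poissonAut br) :
  exists2 g : {rmorphism P -> P}, g =1 f & forall c : K, g c%:MP = c%:MP.
Proof.
have [_ flin fM _] := poissonAutP f.
have fB : zmod_morphism f by move=> u v; rewrite -scaleN1r addrC flin scaleN1r addrC.
have f1M : monoid_morphism f by split; [exact: poisson_aut1|].
pose A := GRing.isZmodMorphism.Build P P f fB.
pose B := GRing.isMonoidMorphism.Build P P f f1M.
pose g : {rmorphism P -> P} := HB.pack (f : P -> P) A B.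
exists g => // c; rewrite /g /= -[c%:MP]mulr1 mul_mpolyC.
have f0 : f 0 = 0 by have := fB 0 0; rewrite !subrr.
by rewrite -[c *: 1]addr0 flin poisson_aut1 f0.
Qed.

Lemma poisson_aut_relations (f : poissonAut br) :
  hesse_relations alpha (fun i => f 'X_i).
Proof.
have [_ _ _ fbr] := poissonAutP f; have [g gf gC] := poisson_aut_rmorphism f.
move=> i; rewrite -fbr hesse_relationsX // -!gf /hesse_grad.
by rewrite rmorphB rmorphXn !rmorphM /= gC !gf.
Qed.

(** The Jacobian determinants of f and of its inverse multiply to 1, and the
units of a polynomial ring are the nonzero constants. *)
Lemma poisson_aut_jacobian (f : poissonAut br) :
  exists2 c, c != 0 & jacobian (f 'X_0) (f 'X_1) (f 'X_2) = c%:MP.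
Proof.
have [g gf gC] := poisson_aut_rmorphism f; have [[h hK fK] _ _ _] := poissonAutP f.
apply: (mpoly_unit_const (q := g (jacobian (h 'X_0) (h 'X_1) (h 'X_2)))).
rewrite -!gf mulrC -jacobian_rmorphism // !gf !fK jacobianE !mderiv_var /=.
ring.
Qed.

Lemma poisson_aut_ext (f g : poissonAut br) : (forall i, f 'X_i = g 'X_i) -> f = g.
Proof.
move=> fg; apply: val_inj; apply/funext => u /=.
have [f' f'E f'C] := poisson_aut_rmorphism f.
have [g' g'E g'C] := poisson_aut_rmorphism g.
rewrite -f'E -g'E; elim/mpoly_ring_ind: u => [c|i|u v IHu IHv|u v IHu IHv].
- by rewrite f'C g'C.
- by rewrite f'E g'E fg.
- by rewrite !rmorphD IHu IHv.
by rewrite !rmorphM IHu IHv.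
Qed.

(** Kept opaque, so that [rotation] never unfolds into an evaluation of
polynomials. *)
Fact rotation_subproof (c : K) s : {g : {rmorphism P -> P} |
  (forall i, g 'X_i = c *: 'X_(i + s)) /\ (forall b : K, g b%:MP = b%:MP)}.
Proof.
exists (mmap (@mpolyC 3 K) (fun i => c *: 'X_(i + s))).
by split=> [i|b]; rewrite /= ?mmapC ?mmapX ?mmap1U.
Qed.

Definition rotation (c : K) s : {rmorphism P -> P} := sval (rotation_subproof c s).

Lemma rotationX (c : K) s i : rotation c s 'X_i = c *: 'X_(i + s).
Proof. exact: (proj1 (svalP (rotation_subproof c s))). Qed.

Lemma rotationC (c : K) s b : rotation c s b%:MP = b%:MP.
Proof. exact: (proj2 (svalP (rotation_subproof c s))). Qed.

Lemma rotationM (c d : K) s t u :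
  rotation c s (rotation d t u) = rotation (c * d) (s + t) u.
Proof.
elim/mpoly_ring_ind: u => [b|i|u v IHu IHv|u v IHu IHv].
- by rewrite !rotationC.
- rewrite !rotationX -mul_mpolyC rmorphM rotationC rotationX mul_mpolyC scalerA.
  by rewrite mulrC -addrA [s + t]addrC.
- by rewrite !rmorphD IHu IHv.
by rewrite !rmorphM IHu IHv.
Qed.

Lemma rotation1 u : rotation 1 0 u = u.
Proof.
elim/mpoly_ring_ind: u => [b|i|u v IHu IHv|u v IHu IHv].
- by rewrite rotationC.
- by rewrite rotationX scale1r addr0.
- by rewrite rmorphD IHu IHv.
by rewrite rmorphM IHu IHv.
Qed.

(** A rotation multiplies each derivative by c, and the gradient of the
potential by c ^+ 2, while shifting the indices; the two sides then agree
term by term. *)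
Lemma rotation_bracket (c : K) s u v :
  rotation c s (br u v) = br (rotation c s u) (rotation c s v).
Proof.
have dE w k : (rotation c s w)^`M(k + s) = c%:MP * rotation c s w^`M(k).
  rewrite (chain_rule (D := mderiv (k + s))) => [|x y|b]; last 2 first.
  - exact: mderivM.
  - by rewrite rotationC /= mderivC.
  rewrite (bigD1 k) //= big1 ?addr0 => [|j /negPf jk].
    by rewrite rotationX mderivZ mderiv_var eqxx -mul_mpolyC mulr1 mulrC.
  by rewrite rotationX mderivZ mderiv_var (inj_eq (addIr s)) jk scaler0 mulr0.
have gE k : rotation c s (grad X k) = c%:MP ^+ 2 * grad X (k + s).
  rewrite /hesse_grad rmorphB rmorphXn !rmorphM rotationC !rotationX.
  rewrite -!mul_mpolyC (addrAC k 1) (addrAC k 2).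
  by move: 'X_(k + s) 'X_(k + s + 1) 'X_(k + s + 2) => x y z; ring.
rewrite !elliptic_bracketE // [RHS](reindex_inj (addIr s)) raddf_sum.
apply: eq_bigr => k _ /=; rewrite rmorphM gE rmorphB !rmorphM.
by rewrite (addrAC k s 1) (addrAC k s 2) !dE; ring.
Qed.

Lemma rotation_poisson c s : `[< is_poisson_aut br (rotation (units_val c) s) >].
Proof.
have cK : units_val c \is a GRing.unit by case: c.
apply/asboolP; split.
- by exists (rotation (units_val c)^-1 (- s)) => u;
    rewrite rotationM ?mulVr ?mulrV // ?addNr ?addrN rotation1.
- by move=> b u v; rewrite -!mul_mpolyC rmorphD rmorphM rotationC.
- exact: rmorphM.
exact: rotation_bracket.
Qed.

Definition rotation_aut (x : units K * 'Z_3) : poissonAut br :=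
  PoissonAut (rotation_poisson x.1 x.2).

Lemma rotation_aut_morph : {morph rotation_aut : x y / (x * y)%g}.
Proof.
move=> x y; apply: val_inj; apply/funext => u.
by rewrite [RHS]rotationM.
Qed.

Lemma rotation_aut_inj : injective rotation_aut.
Proof.
move=> [c s] [d t] cd.
have cdX i : units_val c *: 'X_(i + s) = units_val d *: 'X_(i + t) :> P.
  by have := congr1 (fun f : poissonAut br => f 'X_i) cd; rewrite /= -!rotationX.
have c0 : units_val c != 0 by case: c {cd cdX} => c /=; rewrite unitfE.
have := congr1 (mcoeff U_(s)) (cdX 0); rewrite !mcoeffZ !mcoeffXU !add0r eqxx mulr1.
case: eqP => [ts|_] cE; last by rewrite cE mulr0 eqxx in c0.
by rewrite mulr1 in cE; rewrite ts; congr (_, _); apply: val_inj.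
Qed.

End Automorphisms.

Theorem corollary3 (K : fieldType) (charK : [pchar K] =i pred0)
    (no_root : forall lambda : K, lambda ^+ 2 + lambda + 1 <> 0)
    (alpha : K) (alpha3 : alpha ^+ 3 <> 1) :
  isomorphic_groups (poissonAut (elliptic_bracket alpha)) (units K * 'Z_3)%type.
Proof.
have a3 : alpha ^+ 3 != 1 by apply/eqP.
have surj f : exists x, rotation_aut alpha charK x = f.
  have [c c0 jF] := poisson_aut_jacobian f.
  have [b b0 [s fE]] :=
    relations_cyclic charK a3 no_root (poisson_aut_relations charK f) jF c0.
  have bU : b \is a GRing.unit by rewrite unitfE.
  exists (Units bU, s); apply: poisson_aut_ext => i; rewrite fE; exact: rotationX.
have [g gK] := choice surj.
have Kg : cancel (rotation_aut alpha charK) g.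
  by move=> x; apply: (rotation_aut_inj (charK := charK) (alpha := alpha)).
exists g; first by exists (rotation_aut alpha charK).
move=> f h; apply: (can_inj Kg).
by rewrite rotation_aut_morph !gK.
Qed.
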